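(* Let $\mathsf{ML}$ be any of the fourteen minimal modal logics $\mathsf{MM},\mathsf{MMP},\mathsf{MMN},\mathsf{MMNP},\mathsf{MMC},\mathsf{MK},\mathsf{MMD},\mathsf{MMT},\mathsf{MMND},\mathsf{MMNT},\mathsf{MMCD},\mathsf{MMCT},\mathsf{MKD},\mathsf{MKT}$. For every formula $A$ of $\mathcal L$, if $A$ is valid in every minimal neighbourhood model for $\mathsf{ML}$, then $A$ is derivable in $\mathsf{ML}$.
   Context: $\mathcal L$ is the language $A ::= p \mid \bot \mid A\wedge A \mid A\vee A \mid A\to A \mid \Box A \mid \Diamond A$ over a countable set $\mathrm{Atm}$; $\top:=\bot\to\bot$. $\mathsf{MPL}$ is axiomatised by $A\wedge B\to A$, $A\wedge B\to B$, $A\to A\vee B$, $B\to A\vee B$, $(A\to B)\to((A\to C)\to(A\to B\wedge C))$, $(A\to C)\to((B\to C)\to(A\vee B\to C))$, $(A\to(B\to C))\to((A\to B)\to(A\to C))$, $A\to(B\to A)$, and modus ponens. Modal principles: Mon$\Box$: rule $A\to B/\Box A\to\Box B$; Mon$\Diamond$: rule $A\to B/\Diamond A\to\Diamond B$; N$\Box$: $\Box\top$; C$\Box$: $\Box A\wedge\Box B\to\Box(A\wedge B)$; K$\Diamond$: $\Box(A\to B)\to(\Diamond A\to\Diamond B)$; P$\Diamond$: $\Diamond\top$; D: $\Box A\to\Diamond A$; T$\Box$: $\Box A\to A$; T$\Diamond$: $A\to\Diamond A$. Logics: $\mathsf{MM}=\mathsf{MPL}$+Mon$\Box$+Mon$\Diamond$;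 $\mathsf{MMP}=\mathsf{MM}$+P$\Diamond$; $\mathsf{MMN}=\mathsf{MM}$+N$\Box$; $\mathsf{MMNP}=\mathsf{MMN}$+P$\Diamond$; $\mathsf{MMC}=\mathsf{MM}$+C$\Box$+K$\Diamond$; $\mathsf{MK}=\mathsf{MMC}$+N$\Box$; $\mathsf{MMD}=\mathsf{MM}$+D+P$\Diamond$; $\mathsf{MMT}=\mathsf{MM}$+T$\Box$+T$\Diamond$; $\mathsf{MMND}=\mathsf{MMN}$+D; $\mathsf{MMNT}=\mathsf{MMN}$+T$\Box$+T$\Diamond$; $\mathsf{MMCD}=\mathsf{MMC}$+D+P$\Diamond$; $\mathsf{MMCT}=\mathsf{MMC}$+T$\Box$+T$\Diamond$; $\mathsf{MKD}=\mathsf{MK}$+D; $\mathsf{MKT}=\mathsf{MK}$+T$\Box$+T$\Diamond$. A minimal neighbourhood model is $\langle W,\le,F,N,V\rangle$ with $W\ne\emptyset$, $\le$ reflexive transitive, $F$ and each $V(p)$ upward closed under $\le$, $N:W\to\mathcal P(\mathcal P(W))$. Forcing: $w\Vdash p$ iff $w\in V(p)$; $w\Vdash\bot$ iff $w\in F$; $\wedge,\vee$ pointwise; $w\Vdash B\to C$ iff for all $v\ge w$, $v\Vdash B$ implies $v\Vdash C$; $w\Vdash\Box B$ iff for all $v\ge w$ some $\alpha\in N(v)$ has all its elements forcing $B$; $w\Vdash\Diamond B$ iff for all $v\ge w$, every $\alpha\in N(v)$ contains an element forcing $B$. Conditions: (C) $\alpha,\beta\in N(w)\Rightarrow\alpha\cap\beta\in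 N(w)$; (N) $N(w)\ne\emptyset$; (D) $\alpha,\beta\in N(w)\Rightarrow\alpha\cap\beta\ne\emptyset$; (P) $\emptyset\notin N(w)$; (T) $\alpha\in N(w)\Rightarrow w\in\alpha$. Models for $\mathsf{ML}$ satisfy: $\mathsf{MM}$: none; $\mathsf{MMP}$: P; $\mathsf{MMN}$: N; $\mathsf{MMNP}$: N,P; $\mathsf{MMC}$: C; $\mathsf{MK}$: C,N; $\mathsf{MMD}$: D; $\mathsf{MMT}$: T; $\mathsf{MMND}$: N,D; $\mathsf{MMNT}$: N,T; $\mathsf{MMCD}$: C,D; $\mathsf{MMCT}$: C,T; $\mathsf{MKD}$: C,N,D; $\mathsf{MKT}$: C,N,T. *)

(* Defs.v *)
From mathcomp Require Import all_boot.
From mathcomp Require Import classical_sets.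

Set Implicit Arguments.
Unset Strict Implicit.
Unset Printing Implicit Defensive.

Local Open Scope classical_set_scope.

Inductive formula (Atm : Type) : Type :=
| Atom of Atm
| Bot
| And of formula Atm & formula Atm
| Or of formula Atm & formula Atm
| Imp of formula Atm & formula Atm
| Box of formula Atm
| Dia of formula Atm.

Arguments Bot {Atm}.

Declare Scope mml_scope.
Delimit Scope mml_scope with mml.
Bind Scope mml_scope with formula.
Local Open Scope mml_scope.

Notation "⊥" := Bot : mml_scope.
Notation "⊤" := (Imp Bot Bot) : mml_scope.
Notation "□ A" := (Box A) (at level 35, A at level 35, right associativity) : mml_scope.
Notation "◇ A" := (Dia A) (at level 35, A at level 35, right associativity) : mml_scope.
Notation "A ∧ B" := (And A B) (at level 40, left associativity) : mml_scope.
Notation "A ∨ B" := (Or A B) (at level 50, left associativity) : mml_scope.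
Notation "A ⇒ B" := (Imp A B) (at level 55, right associativity) : mml_scope.

(* Modal axiom schemes; the rules of monotonicity belong to every logic and
   appear as constructors of [derivable]. *)
Inductive principle :=
  NBox | CBox | KDia | PDia | DBoxDia | TBox | TDia.

Inductive modal_instance (Atm : Type) : principle -> set (formula Atm) :=
| inst_NBox : modal_instance NBox (□ ⊤)
| inst_CBox A B : modal_instance CBox (□ A ∧ □ B ⇒ □ (A ∧ B))
| inst_KDia A B : modal_instance KDia (□ (A ⇒ B) ⇒ (◇ A ⇒ ◇ B))
| inst_PDia : modal_instance PDia (◇ ⊤)
| inst_D A : modal_instance DBoxDia (□ A ⇒ ◇ A)
| inst_TBox A : modal_instance TBox (□ A ⇒ A)
| inst_TDia A : modal_instance TDia (A ⇒ ◇ A).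

Inductive minimal_logic :=
| MM | MMP | MMN | MMNP | MMC | MK | MMD | MMT
| MMND | MMNT | MMCD | MMCT | MKD | MKT.

Definition principles (L : minimal_logic) : set principle :=
  match L with
  | MM => set0
  | MMP => [set PDia]
  | MMN => [set NBox]
  | MMNP => [set NBox; PDia]
  | MMC => [set CBox; KDia]
  | MK => [set CBox; KDia; NBox]
  | MMD => [set DBoxDia; PDia]
  | MMT => [set TBox; TDia]
  | MMND => [set NBox; DBoxDia]
  | MMNT => [set NBox; TBox; TDia]
  | MMCD => [set CBox; KDia; DBoxDia; PDia]
  | MMCT => [set CBox; KDia; TBox; TDia]
  | MKD => [set CBox; KDia; NBox; DBoxDia]
  | MKT => [set CBox; KDia; NBox; TBox; TDia]
  end.

Inductive derivable (Atm : Type) (L : minimal_logic) : set (formula Atm) :=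
| ax_andl A B : derivable L (A ∧ B ⇒ A)
| ax_andr A B : derivable L (A ∧ B ⇒ B)
| ax_orl A B : derivable L (A ⇒ A ∨ B)
| ax_orr A B : derivable L (B ⇒ A ∨ B)
| ax_and A B C : derivable L ((A ⇒ B) ⇒ ((A ⇒ C) ⇒ (A ⇒ B ∧ C)))
| ax_or A B C : derivable L ((A ⇒ C) ⇒ ((B ⇒ C) ⇒ (A ∨ B ⇒ C)))
| ax_S A B C : derivable L ((A ⇒ (B ⇒ C)) ⇒ ((A ⇒ B) ⇒ (A ⇒ C)))
| ax_K A B : derivable L (A ⇒ (B ⇒ A))
| ax_modal p A : principles L p -> modal_instance p A -> derivable L A
| rule_mp A B : derivable L (A ⇒ B) -> derivable L A -> derivable L B
| rule_monBox A B : derivable L (A ⇒ B) -> derivable L (□ A ⇒ □ B)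
| rule_monDia A B : derivable L (A ⇒ B) -> derivable L (◇ A ⇒ ◇ B).

Record model (Atm : Type) := Model {
  world : Type;
  le : world -> world -> Prop;
  fallible : set world; (* the set F: worlds forcing ⊥ *)
  nbhd : world -> set (set world);
  val : Atm -> set world;
  world_inhabited : inhabited world;
  le_refl : forall w, le w w;
  le_trans : forall u v w, le u v -> le v w -> le u w;
  fallible_up : forall w v, le w v -> fallible w -> fallible v;
  val_up : forall p w v, le w v -> val p w -> val p v }.

Arguments le {Atm m}.
Arguments fallible {Atm m}.
Arguments nbhd {Atm m}.
Arguments val {Atm m}.

Fixpoint forces (Atm : Type) (M : model Atm) (w : world M)
    (A : formula Atm) {struct A} : Prop :=
  match A with
  | Atom p => val p w
  | Bot => fallible w
  | And B C => forces w B /\ forces w C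
  | Or B C => forces w B \/ forces w C
  | Imp B C => forall v, le w v -> forces v B -> forces v C
  | Box B => forall v, le w v ->
      exists2 a, nbhd v a & forall u, a u -> forces u B
  | Dia B => forall v, le w v ->
      forall a, nbhd v a -> exists2 u, a u & forces u B
  end.

Definition valid (Atm : Type) (M : model Atm) (A : formula Atm) : Prop :=
  forall w : world M, forces w A.

Inductive condition := condC | condN | condD | condP | condT.

Definition satisfies (Atm : Type) (M : model Atm) (c : condition) : Prop :=
  match c with
  | condC => forall (w : world M) a b,
      nbhd w a -> nbhd w b -> nbhd w (a `&` b)
  | condN => forall w : world M, nbhd w !=set0
  | condD => forall (w : world M) a b,
      nbhd w a -> nbhd w b -> a `&` b !=set0
  | condP => forall w : world M, ~ nbhd w set0
  | condT => forall (w : world M) a, nbhd w a -> a w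
  end.

Definition conditions (L : minimal_logic) : set condition :=
  match L with
  | MM => set0
  | MMP => [set condP]
  | MMN => [set condN]
  | MMNP => [set condN; condP]
  | MMC => [set condC]
  | MK => [set condC; condN]
  | MMD => [set condD]
  | MMT => [set condT]
  | MMND => [set condN; condD]
  | MMNT => [set condN; condT]
  | MMCD => [set condC; condD]
  | MMCT => [set condC; condT]
  | MKD => [set condC; condN; condD]
  | MKT => [set condC; condN; condT]
  end.

Definition model_for (Atm : Type) (L : minimal_logic) (M : model Atm) : Prop :=
  forall c, conditions L c -> satisfies M c.

(* Main.v *)
(** Completeness is proved with a canonical model whose worlds are pairs of a
    prime theory [T] and an optional formula [B] with [◇ B ∉ T].  Write |A|
    for the set of worlds whose theory contains [A].  The neighbourhoods of a
    world are the sets |A| with [□ A ∈ T], together with the complement of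
    |B| when [B] is present, which is what refutes [◇ B]; with C□ one also
    closes under intersection.  Theories may contain [⊥], so the set of all
    formulas is a prime theory lying in every |A|: hence every |A| meets
    every |C|, whatever diamonds [T] contains. *)
Require Import Defs.
From mathcomp Require Import all_boot.
From mathcomp Require Import boolp classical_sets.

Set Implicit Arguments.
Unset Strict Implicit.
Unset Printing Implicit Defensive.

Local Open Scope classical_set_scope.
Local Open Scope mml_scope.

Section Completeness.
Variables (Atm : Type) (L : minimal_logic).
Implicit Types (A B C D : formula Atm) (S T : set (formula Atm)).

(** * Theories, prime theories and Lindenbaum's lemma *)

Record theory T : Prop := Theory {
  theory_der : forall A, derivable L A -> T A;
  theory_mp : forall A B, T (A ⇒ B) -> T A -> T B }.

Record prime_theory T : Prop := PrimeTheory {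
  prime_is_theory : theory T;
  prime_or : forall A B, T (A ∨ B) -> T A \/ T B }.

Lemma derivable_imp_refl A : derivable L (A ⇒ A).
Proof.
by apply: rule_mp (ax_K L A A); apply: rule_mp (ax_K L A (A ⇒ A)); apply: ax_S.
Qed.

Lemma theory_derivable : theory (@derivable Atm L).
Proof. by split=> // A B; apply: rule_mp. Qed.

Lemma theory_imp T A B : theory T -> derivable L (A ⇒ B) -> T A -> T B.
Proof. by move=> thT /(theory_der thT); apply: theory_mp. Qed.

Lemma theory_and T A B : theory T -> T A -> T B -> T (A ∧ B).
Proof.
move=> thT TA TB; apply: (theory_mp thT) TA.
have TAB : T (A ⇒ B) by apply: (theory_imp thT) TB; exact: ax_K.
apply: (theory_mp thT) TAB; apply: (theory_mp thT).
  exact: (theory_der thT (ax_and L A A B)).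
exact: (theory_der thT (derivable_imp_refl A)).
Qed.

(** This is the theory generated by [T] and [A], in a form that makes the deduction theorem true by
    definition; closure under modus ponens is [ax_S]. *)
Lemma theory_extend T A : theory T -> theory [set B | T (A ⇒ B)].
Proof.
move=> thT; split=> [B dB | B C TABC TAB] /=.
  by apply: (theory_imp thT (ax_K L B A)); apply: (theory_der thT).
by apply: (theory_mp thT) TAB; apply: (theory_imp thT) TABC; exact: ax_S.
Qed.

Lemma sub_theory_extend T A : theory T -> T `<=` [set B | T (A ⇒ B)].
Proof. by move=> thT B; apply: theory_imp => //; apply: ax_K. Qed.

Lemma prime_extension T B : theory T -> ~ T B ->
  exists S, [/\ prime_theory S, T `<=` S & ~ S B].
Proof.
move=> thT nTB.
(* Zorn is applied to [T `|` X] so that the empty chain has an upper bound. *)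
pose P X := theory (T `|` X) /\ ~ (T `|` X) B.
have chainP (F : set (set (formula Atm))) : F `<=` P -> total_on F subset ->
    P (\bigcup_(X in F) X).
  move=> FP Ftot; split; last first.
    by case=> // -[X FX XB]; case: (FP X FX) => _; apply; right.
  split=> [A dA | A C]; first by left; apply: (theory_der thT).
  have up X : F X -> T `|` X `<=` T `|` \bigcup_(Y in F) Y.
    by move=> FX D [TD|XD]; [left | right; exists X].
  case=> [TAC|[X FX XAC]] [TA|[Y FY YA]].
  - by left; apply: (theory_mp thT) TAC TA.
  - apply: (up _ FY); have [thY _] := FP _ FY.
    by apply: (theory_mp thY); [left; exact: TAC | right].
  - apply: (up _ FX); have [thX _] := FP _ FX.
    by apply: (theory_mp thX); [right; exact: XAC | left].
  - case: (Ftot _ _ FX FY) => [XY|YX].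
      apply: (up _ FY); have [thY _] := FP _ FY.
      by apply: (theory_mp thY); right; [exact: XY XAC | ].
    apply: (up _ FX); have [thX _] := FP _ FX.
    by apply: (theory_mp thX); right; [exact: XAC | exact: YX].
have [X [[thS nSB] maxX]] := Zorn_bigcup chainP.
exists (T `|` X); split; [| by move=> A TA; left | exact: nSB].
split=> [|A C SAC]; first exact: thS.
(* For [D] outside the maximal theory, the theory generated by adding [D] is strictly larger, so it
   must contain [B]. If both disjuncts were outside, [ax_or] would then put [B] inside. *)
have maxS D : ~ (T `|` X) D -> (T `|` X) (D ⇒ B).
  move=> nSD; apply: contrapT => nSDB.
  have sub := sub_theory_extend D thS.
  apply: (maxX [set E | (T `|` X) (D ⇒ E)]); last first.
    have eqS : T `|` [set E | (T `|` X) (D ⇒ E)] = [set E | (T `|` X) (D ⇒ E)].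
      by rewrite setUidr // => E TE; apply: sub; left.
    by split; rewrite eqS //; apply: theory_extend.
  split=> [E XE | subX]; first by apply: sub; right.
  apply: nSD; right; apply: subX.
  exact: (theory_der thS (derivable_imp_refl D)).
apply: contrapT => /not_orP[/maxS SAB /maxS SCB]; apply: nSB.
apply: (theory_mp thS) SAC; apply: (theory_mp thS) SCB.
by apply: (theory_imp thS) SAB; exact: ax_or.
Qed.

Lemma prime_extension_imp T A B : theory T -> ~ T (A ⇒ B) ->
  exists S, [/\ prime_theory S, T `<=` S, S A & ~ S B].
Proof.
move=> thT nTAB.
have [S [pS TS nSB]] := prime_extension (theory_extend A thT) nTAB.
exists S; split=> //; first exact: subset_trans (sub_theory_extend A thT) TS.
exact/TS/(theory_der thT)/derivable_imp_refl.
Qed.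

(** * From frame conditions to axioms, by inspection of the fourteen logics *)

Lemma condC_CBox : conditions L condC -> principles L CBox.
Proof. by case: L => /=; intuition discriminate. Qed.

Lemma CBox_KDia : principles L CBox -> principles L KDia.
Proof. by case: L => /=; intuition discriminate. Qed.

Lemma condN_NBox : conditions L condN -> principles L NBox.
Proof. by case: L => /=; intuition discriminate. Qed.

Lemma condT_principles : conditions L condT ->
  principles L TBox /\ principles L TDia.
Proof. by case: L => /=; intuition discriminate. Qed.

(** Each such logic either has P◇ as an axiom or has both N□ and D, and then [□ ⊤] yields [◇ ⊤]. *)
Lemma condDP_dia_top : conditions L condD \/ conditions L condP ->
  derivable L (◇ ⊤ : formula Atm).
Proof.
have viaP : principles L PDia -> derivable L (◇ ⊤ : formula Atm).
  by move=> /ax_modal; apply; exact: inst_PDia.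
have viaND : principles L NBox /\ principles L DBoxDia ->
    derivable L (◇ ⊤ : formula Atm).
  case=> hN hD; apply: rule_mp (ax_modal hN (inst_NBox _)).
  exact: ax_modal hD (inst_D _).
by move=> LDP; have [/viaP|/viaND] : principles L PDia \/
  principles L NBox /\ principles L DBoxDia
  by move: LDP {viaP viaND}; case: L => /=; intuition discriminate.
Qed.

Lemma condD_DBoxDia : conditions L condD -> principles L DBoxDia.
Proof. by case: L => /=; intuition discriminate. Qed.

Lemma condP_notCBox : conditions L condP -> ~ principles L CBox.
Proof. by case: L => /=; intuition discriminate. Qed.

(** * The canonical model *)

Record cworld : Type := CWorld {
  th : set (formula Atm);
  refuted : option (formula Atm);
  th_prime : prime_theory th;
  refutedN : forall B, refuted = Some B -> ~ th (◇ B) }.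

Lemma th_theory w : theory (th w).
Proof. exact: prime_is_theory (th_prime w). Qed.

Definition plain_world T (pT : prime_theory T) : cworld :=
  @CWorld T None pT (fun B (e : None = Some B) => ltac:(done)).

Lemma prime_setT : prime_theory setT.
Proof. by split=> // A B; left. Qed.

Definition full_world : cworld := plain_world prime_setT.

Definition truth_set A : set cworld := [set w | th w A].

Inductive cnbhd (w : cworld) : set (set cworld) :=
| cnbhd_box A : th w (□ A) -> cnbhd w (truth_set A)
| cnbhd_dia B : refuted w = Some B -> cnbhd w (~` truth_set B)
| cnbhd_boxdia A B : principles L CBox -> th w (□ A) -> refuted w = Some B ->
    cnbhd w (truth_set A `&` ~` truth_set B).

Definition canonical_model : model Atm :=
  @Model Atm cworld (fun w v => th w `<=` th v) (truth_set Bot) cnbhd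
    (fun p => truth_set (Atom p)) (inhabits full_world)
    (fun w => @subset_refl _ (th w))
    (fun u v w uv vw => subset_trans uv vw)
    (fun w v wv => wv Bot) (fun p w v wv => wv (Atom p)).

Lemma truth_setI A B : truth_set A `&` truth_set B = truth_set (A ∧ B).
Proof.
apply/seteqP; split=> w /=; first by
  case=> wA wB; exact: theory_and (th_theory w) wA wB.
by move=> wAB; split; apply: (theory_imp (th_theory w)) wAB;
  [exact: ax_andl | exact: ax_andr].
Qed.

Lemma cworld_separation w A B : ~ th w (A ⇒ B) ->
  exists v, [/\ th w `<=` th v, th v A & ~ th v B].
Proof.
move=> /(prime_extension_imp (th_theory w))[S [pS wS SA nSB]].
by exists (plain_world pS).
Qed.

Lemma underivable_separation A B : ~ derivable L (A ⇒ B) ->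
  exists v, th v A /\ ~ th v B.
Proof.
move=> /(prime_extension_imp theory_derivable)[S [pS _ SA nSB]].
by exists (plain_world pS).
Qed.

(** Otherwise [C ⇒ B] is derivable and Mon◇ gives [◇ B]. The world [v] need not lie above [w], since
    elements of neighbourhoods are unrelated to the order. *)
Lemma dia_separation w C B : th w (◇ C) -> ~ th w (◇ B) ->
  exists v, th v C /\ ~ th v B.
Proof.
move=> wC nwB; apply: underivable_separation => dCB; apply: nwB.
exact: theory_imp (th_theory w) (rule_monDia dCB) wC.
Qed.

(** If [A ⇒ (C ⇒ B)] were derivable, Mon□ and K◇ would give [◇ B] in [w]. So some [u] has [A] and
    lacks [C ⇒ B], and a world above [u] separates [C] from [B]. *)
Lemma box_dia_separation w A C B : principles L KDia ->
  th w (□ A) -> th w (◇ C) -> ~ th w (◇ B) ->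
  exists v, [/\ th v A, th v C & ~ th v B].
Proof.
move=> hK wA wC nwB.
have [u [uA nuCB]] : exists u, th u A /\ ~ th u (C ⇒ B).
  apply: underivable_separation => dACB; apply: nwB.
  have thw := th_theory w; apply: (theory_mp thw) wC.
  apply: (theory_imp thw (ax_modal hK (inst_KDia _ _))).
  exact: theory_imp (rule_monBox dACB) wA.
by have [v [uv vC nvB]] := cworld_separation nuCB; exists v; split=> //; exact: uv.
Qed.

Lemma box_refuted_separation w A B : principles L DBoxDia ->
  th w (□ A) -> ~ th w (◇ B) -> exists v, th v A /\ ~ th v B.
Proof.
move=> hD wA; apply: dia_separation.
exact: theory_imp (th_theory w) (ax_modal hD (inst_D _)) wA.
Qed.

Lemma truth_lemma A (w : cworld) :
  forces (M := canonical_model) w A <-> th w A.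
Proof.
elim: A w => [p|/=|A IHA B IHB|A IHA B IHB|A IHA B IHB|B IHB|B IHB] w //=.
- rewrite IHA IHB; have := truth_setI A B.
  by move=> /seteqP[sub1 sub2]; split=> [|/sub2//]; exact: sub1.
- rewrite IHA IHB; split; last by move=> /(prime_or (th_prime w)).
  by case; apply: (theory_imp (th_theory w)); [exact: ax_orl | exact: ax_orr].
- split=> [wAB | wAB v wv /IHA vA].
    apply: contrapT => /cworld_separation[v [wv vA nvB]].
    by apply/nvB/IHB/(wAB v wv)/IHA.
  by apply/IHB; apply: (theory_mp (th_theory v)) vA; exact: wv.
- split=> [wB | wB v wv]; last first.
    by exists (truth_set B) => [|u /IHB//]; exact/cnbhd_box/wv.
  (* Same theory as [w] but no refuted formula: only neighbourhoods coming from boxes remain. *)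
  have [a na aB] := wB (plain_world (th_prime w)) (@subset_refl _ _).
  case: na aB => // A wA AB; apply: contrapT => nwB.
  have [|v [vA nvB]] := @underivable_separation A B.
    by move=> /rule_monBox dAB; apply/nwB/(theory_imp (th_theory w) dAB).
  by apply/nvB/IHB/AB.
- split=> [wB | wB v /(_ _ wB) vB a].
    apply: contrapT => nwB.
    have ref C : Some B = Some C -> ~ th w (◇ C) by case=> <-.
    (* The same theory, now with [B] as refuted formula, so that the complement of [truth_set B] is
       a neighbourhood. *)
    pose v := CWorld (th_prime w) ref.
    have nv : cnbhd v (~` truth_set B) by apply: cnbhd_dia.
    by have [u nuB /IHB] := wB v (@subset_refl _ _) _ nv.
  case=> [A vA | C /refutedN nvC | A C hC vA /refutedN nvC].
  - by exists full_world => //; exact/IHB.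
  - by have [u [uB nuC]] := dia_separation vB nvC; exists u => //; exact/IHB.
  - have [u [uA uB nuC]] := box_dia_separation (CBox_KDia hC) vA vB nvC.
    by exists u; [split | exact/IHB].
Qed.

(** * Frame conditions of the canonical model *)

(** One box and one refuted formula suffice: C□ merges two boxes, and a world has at most one
    refuted formula. *)
Lemma cnbhdI w a b : principles L CBox ->
  cnbhd w a -> cnbhd w b -> cnbhd w (a `&` b).
Proof.
move=> hC.
have box_and A B : th w (□ A) -> th w (□ B) -> th w (□ (A ∧ B)).
  move=> wA wB; have thw := th_theory w.
  by apply: (theory_imp thw (ax_modal hC (inst_CBox _ _))); apply: theory_and.
have refuted_eq B C : refuted w = Some B -> refuted w = Some C -> B = C.
  by move=> -> [].
case=> [A wA|B rB|A B _ wA rB] [A' wA'|B' rB'|A' B' _ wA' rB'].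
- by rewrite truth_setI; apply/cnbhd_box/box_and.
- exact: cnbhd_boxdia.
- by rewrite setIA truth_setI; apply: cnbhd_boxdia => //; exact: box_and.
- by rewrite setIC; exact: cnbhd_boxdia.
- by rewrite (refuted_eq _ _ rB rB') setIid; exact: cnbhd_dia.
- by rewrite (refuted_eq _ _ rB rB') setICA setIid; exact: cnbhd_boxdia.
- by rewrite setIAC truth_setI; apply: cnbhd_boxdia => //; exact: box_and.
- by rewrite (refuted_eq _ _ rB rB') -setIA setIid; exact: cnbhd_boxdia.
- rewrite (refuted_eq _ _ rB rB') setIACA setIid truth_setI.
  by apply: cnbhd_boxdia => //; exact: box_and.
Qed.

(** A complement is nonempty because [◇ ⊤] holds and [◇ B] fails at [w]. The mixed neighbourhoods
    need D; they do not arise under P, which never occurs together with C□. *)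
Lemma cnbhd_nonempty w a : conditions L condD \/ conditions L condP ->
  cnbhd w a -> a !=set0.
Proof.
move=> LDP; case=> [A _ | B /refutedN nwB | A B hC wA /refutedN nwB].
- by exists full_world.
- have wtop : th w (◇ ⊤) by apply/(theory_der (th_theory w))/condDP_dia_top.
  by have [v [_ nvB]] := dia_separation wtop nwB; exists v.
- case: LDP => [/condD_DBoxDia hD|/condP_notCBox//].
  by have [v [vA nvB]] := box_refuted_separation hD wA nwB; exists v.
Qed.

Lemma canonical_model_for : model_for L canonical_model.
Proof.
case=> /= Lc.
- by move=> w a b; apply/cnbhdI/condC_CBox.
- move=> w; exists (truth_set ⊤); apply/cnbhd_box/(theory_der (th_theory w)).
  exact: ax_modal (condN_NBox Lc) (inst_NBox _).
- have hD := condD_DBoxDia Lc.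
  (* With C□ the intersection is itself a neighbourhood; without it, the mixed neighbourhoods are
     absent and four pairs remain. *)
  move=> w a b na nb; have [hC|nC] := pselect (principles L CBox).
    by apply: cnbhd_nonempty (cnbhdI hC na nb); left.
  case: na nb => [A wA|B rB|//] [A' wA'|B' rB'|//].
  + by exists full_world.
  + exact: box_refuted_separation hD wA (refutedN rB').
  + by rewrite setIC; exact: box_refuted_separation hD wA' (refutedN rB).
  + move: rB'; rewrite rB => -[<-]; rewrite setIid.
    by apply: (@cnbhd_nonempty w); [left | exact: cnbhd_dia].
- by move=> w n0; have [v []] := cnbhd_nonempty (or_intror Lc) n0.
(* T□ puts [w] in the truth set of each boxed formula; T◇ keeps the refuted formula out of
   [th w]. *)
- have [hB hT] := condT_principles Lc; move=> w a.
  have thw := th_theory w.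
  have box_in A : th w (□ A) -> th w A.
    exact: theory_imp (ax_modal hB (inst_TBox _)).
  have refuted_out B : refuted w = Some B -> ~ th w B.
    move=> /refutedN nwB wB; apply: nwB.
    exact: theory_imp (ax_modal hT (inst_TDia _)) wB.
  case=> [A /box_in//|B /refuted_out//|A B _ /box_in wA /refuted_out//].
Qed.

End Completeness.

Theorem mainTheorem14 (Atm : countType) (L : minimal_logic) (A : formula Atm) :
  (forall M : model Atm, model_for L M -> valid M A) -> derivable L A.
Proof.
move=> validA; apply: contrapT => ndA.
have [|w [_ nwA]] := @underivable_separation Atm L (⊤) A.
  by move=> /rule_mp dA; apply/ndA/dA/derivable_imp_refl.
exact/nwA/truth_lemma/(validA _ (@canonical_model_for Atm L)).
Qed.
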